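(* Let $A\in\mathbb{R}^{m\times n}$ and $r_\theta\in\mathbb{R}^m$ with $A^Tr_\theta\neq 0$. Let $S\in\mathbb{R}^{s\times m}$ and let $\eta\geq 0$ be a real number such that $$(1-\eta)\|Ay\|_2\le\|S(Ay)\|_2\le(1+\eta)\|Ay\|_2\quad\text{for all }y\in\mathbb{R}^n.$$ Define $$\widetilde p=\left((SA)^T(SA)+\|r_\theta\|_2^2I\right)^{-1}A^Tr_\theta.$$ Then $$\frac{1-\eta^2}{1+\eta^2}\,\nu(A,r_\theta)\le\mu\left(A\widetilde p/\|\widetilde p\|_2,\,r_\theta\right)\le\mu(A,r_\theta).$$
   Context: Here $m,n,s$ are positive integers. For real matrices $A\in\mathbb{R}^{m\times n}$ and $R\in\mathbb{R}^{m\times d}$ with the same number of rows, define the backward error $$\mu(A,R)=\min_Y\left(\|YY^\dagger A\|_F^2+\|(I-YY^\dagger)R\|_F^2\right)^{1/2},$$ where $Y$ ranges over all real matrices with $m$ rows (any number of columns), $Y^\dagger$ is the Moore-Penrose inverse of $Y$ (so $YY^\dagger$ ranges over all orthogonal projectors on $\mathbb{R}^m$), and $\|\cdot\|_F$ is the Frobenius norm. Vectors in $\mathbb{R}^m$ are viewed as $m\times 1$ matrices. For $A\in\mathbb{R}^{m\times n}$ and $r_\theta\in\mathbb{R}^m$, the Karlson-Waldén estimate is $$\nu(A,r_\theta)=\max_{\|p\|_2=1}\frac{|p^TA^Tr_\theta|}{(\|Ap\|_2^2+\|r_\theta\|_2^2)^{1/2}}=\left\|(A^TA+\|r_\theta\|_2^2I)^{-1/2}A^Tr_\theta\right\|_2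 .$$ *)

(* Defs.v *)
From HB Require Import structures.
From mathcomp Require Import all_boot all_order all_algebra.
From mathcomp Require Import all_classical all_reals all_analysis.

Set Implicit Arguments.
Unset Strict Implicit.
Unset Printing Implicit Defensive.

Import Order.TTheory GRing.Theory Num.Theory.
Import numFieldNormedType.Exports.

Local Open Scope classical_set_scope.
Local Open Scope ring_scope.

(* The library norm [`|A|] on matrices is the maximum of the entries, hence
   this definition. For a column vector, [fnorm] is the Euclidean norm. *)
Definition fnorm (R : realType) (m n : nat) (A : 'M[R]_(m, n)) : R :=
  Num.sqrt (\sum_i \sum_j A i j ^+ 2).

Definition penrose (R : realType) (m k : nat)
    (Y : 'M[R]_(m, k)) (X : 'M[R]_(k, m)) : Prop :=
  [/\ Y *m X *m Y = Y, X *m Y *m X = X,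
      (Y *m X)^T = Y *m X & (X *m Y)^T = X *m Y].

(* The default value 0 is never used: see [mpinvP] and [penrose_uniq]. *)
Definition mpinv (R : realType) (m k : nat) (Y : 'M[R]_(m, k)) : 'M[R]_(k, m) :=
  xget 0 [set X | penrose Y X].

Definition mu_obj (R : realType) (m n d : nat) (A : 'M[R]_(m, n))
    (B : 'M[R]_(m, d)) (k : nat) (Y : 'M[R]_(m, k)) : R :=
  Num.sqrt (fnorm (Y *m mpinv Y *m A) ^+ 2
            + fnorm ((1%:M - Y *m mpinv Y) *m B) ^+ 2).

(* The infimum is a minimum: see [mu_attained]. *)
Definition mu (R : realType) (m n d : nat) (A : 'M[R]_(m, n))
    (B : 'M[R]_(m, d)) : R :=
  inf [set v | exists k (Y : 'M[R]_(m, k)), v = mu_obj A B Y].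

Definition nu_obj (R : realType) (m n : nat) (A : 'M[R]_(m, n))
    (r : 'cV[R]_m) (p : 'cV[R]_n) : R :=
  `|(p^T *m A^T *m r) 0 0| / Num.sqrt (fnorm (A *m p) ^+ 2 + fnorm r ^+ 2).

(* The supremum is a maximum when [0 < n] and [r != 0]: see [nu_attained]. *)
Definition nu (R : realType) (m n : nat) (A : 'M[R]_(m, n))
    (r : 'cV[R]_m) : R :=
  sup [set nu_obj A r p | p in [set p | fnorm p = 1]].

Lemma fnorm_ge0 (R : realType) (m n : nat) (A : 'M[R]_(m, n)) : 0 <= fnorm A.
Proof. exact: sqrtr_ge0. Qed.

Lemma fnorm_sqr (R : realType) (m n : nat) (A : 'M[R]_(m, n)) :
  fnorm A ^+ 2 = \sum_i \sum_j A i j ^+ 2.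
Proof.
by rewrite sqr_sqrtr// sumr_ge0// => i _; rewrite sumr_ge0// => j _; rewrite sqr_ge0.
Qed.

Lemma fnorm_eq0 (R : realType) (m n : nat) (A : 'M[R]_(m, n)) :
  (fnorm A == 0) = (A == 0).
Proof.
apply/eqP/eqP => [A0|->]; last first.
  rewrite /fnorm big1 ?sqrtr0// => i _; rewrite big1// => j _.
  by rewrite mxE expr0n.
have := fnorm_sqr A; rewrite A0 expr0n => /esym/eqP.
rewrite psumr_eq0 => [/allP S0|i _]; last first.
  by rewrite sumr_ge0// => j _; rewrite sqr_ge0.
apply/matrixP => i j; rewrite mxE.
have /eqP := S0 i (mem_index_enum i).
move=> /eqP; rewrite psumr_eq0 => [/allP/(_ j (mem_index_enum j))|k _].
  by rewrite /= sqrf_eq0 => /eqP.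
by rewrite sqr_ge0.
Qed.

Lemma mulmx_trmx_eq0 (R : realType) (m n : nat) (M : 'M[R]_(m, n)) :
  M *m M^T = 0 -> M = 0.
Proof.
move=> MM; apply/eqP; rewrite -fnorm_eq0 -sqrf_eq0 fnorm_sqr.
apply/eqP; rewrite big1// => i _.
move/matrixP: MM => /(_ i i); rewrite !mxE; apply: etrans.
by apply: eq_bigr => j _; rewrite mxE expr2.
Qed.

Lemma gram_unit (R : realType) (r k : nat) (C : 'M[R]_(r, k)) :
  row_free C -> C *m C^T \in unitmx.
Proof.
move=> Cfree; rewrite -row_free_unit -kermx_eq0.
set K := kermx _.
rewrite -(mulmx_free_eq0 K Cfree); apply/eqP/mulmx_trmx_eq0.
by rewrite trmx_mul mulmxA -(mulmxA K) mulmx_ker mul0mx.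
Qed.

Lemma penrose_factor (R : realType) (m r k : nat)
    (B : 'M[R]_(m, r)) (C : 'M[R]_(r, k)) :
  row_full B -> row_free C -> exists X, penrose (B *m C) X.
Proof.
move=> Bfull Cfree.
have Cu : C *m C^T \in unitmx by exact: gram_unit.
have Bu : B^T *m B \in unitmx.
  by rewrite -{2}(trmxK B); apply: gram_unit; rewrite /row_free mxrank_tr.
pose G := invmx (C *m C^T); pose H := invmx (B^T *m B).
have GT : G^T = G by rewrite /G trmx_inv trmx_mul trmxK.
have HT : H^T = H by rewrite /H trmx_inv trmx_mul trmxK.
have CG : C *m (C^T *m G) = 1%:M by rewrite mulmxA mulmxV.
have HB : H *m B^T *m B = 1%:M by rewrite -mulmxA mulVmx.
pose X := C^T *m G *m (H *m B^T).
have YX : B *m C *m X = B *m (H *m B^T).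
  by rewrite /X mulmxA -(mulmxA B) CG mulmx1.
have XY : X *m (B *m C) = C^T *m G *m C.
  by rewrite /X -mulmxA (mulmxA _ B) HB mul1mx.
exists X; split.
- by rewrite YX -mulmxA (mulmxA _ B) HB mul1mx.
- by rewrite XY /X mulmxA -(mulmxA _ C) CG mulmx1.
- by rewrite YX !trmx_mul trmxK HT mulmxA.
- by rewrite XY !trmx_mul trmxK GT mulmxA.
Qed.

Lemma penrose_exists (R : realType) (m k : nat) (Y : 'M[R]_(m, k)) :
  exists X, penrose Y X.
Proof.
have := penrose_factor (col_base_full Y) (row_base_free Y).
by rewrite mulmx_base.
Qed.

Lemma mpinvP (R : realType) (m k : nat) (Y : 'M[R]_(m, k)) :
  penrose Y (mpinv Y).
Proof. by have [X PX] := penrose_exists Y; apply: (xgetI 0 PX). Qed.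

Lemma penrose_uniq (R : realType) (m k : nat) (Y : 'M[R]_(m, k))
    (X Z : 'M[R]_(k, m)) : penrose Y X -> penrose Y Z -> X = Z.
Proof.
move=> [X1 X2 X3 X4] [Z1 Z2 Z3 Z4].
have e1 : Y *m X = Y *m Z.
  by rewrite -X3 -{1}Z1 -(mulmxA (Y *m Z)) trmx_mul X3 Z3 mulmxA X1.
have e2 : X *m Y = Z *m Y.
  by rewrite -X4 -{1}Z1 -mulmxA mulmxA trmx_mul Z4 X4 -mulmxA (mulmxA Y) X1.
by rewrite -X2 e2 -mulmxA e1 mulmxA Z2.
Qed.

Definition is_proj (R : realType) (m : nat) (P : 'M[R]_m) : Prop :=
  P *m P = P /\ P^T = P.

Lemma mpinv_proj (R : realType) (m k : nat) (Y : 'M[R]_(m, k)) :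
  is_proj (Y *m mpinv Y).
Proof. by have [Y1 _ Y3 _] := mpinvP Y; split; rewrite // mulmxA Y1. Qed.

Lemma proj_mpinv (R : realType) (m : nat) (P : 'M[R]_m) :
  is_proj P -> P *m mpinv P = P.
Proof.
move=> [PP PT]; rewrite -(@penrose_uniq _ _ _ P P (mpinv P))//; last exact: mpinvP.
by split; rewrite ?PP.
Qed.

Lemma continuous_sum (R : realType) (T : topologicalType) (I : Type)
    (s : seq I) (f : I -> T -> R) :
  (forall i, continuous (f i)) -> continuous (fun x => \sum_(i <- s) f i x).
Proof.
move=> cf x; elim: s => [|i s IHs].
  rewrite [X in continuous_at _ X](_ : _ = cst 0); first exact: cvg_cst.
  by apply/funext => y; rewrite big_nil.
rewrite [X in continuous_at _ X](_ : _ = f i \+ (fun y => \sum_(i <- s) f i y)).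
  by apply: cvgD => //; exact: cf.
by apply/funext => y; rewrite big_cons.
Qed.

Lemma continuous_mulmx (R : realType) (T : topologicalType) (a b c : nat)
    (f : T -> 'M[R]_(a, b)) (g : T -> 'M[R]_(b, c)) :
  (forall i j, continuous (fun x => f x i j)) ->
  (forall i j, continuous (fun x => g x i j)) ->
  forall i j, continuous (fun x => (f x *m g x) i j).
Proof.
move=> cf cg i j.
rewrite [X in continuous X](_ : _ = fun x => \sum_k f x i k * g x k j).
  by apply: continuous_sum => k x; apply: cvgM; [exact: cf | exact: cg].
by apply/funext => x; rewrite mxE.
Qed.

Lemma continuous_submx (R : realType) (T : topologicalType) (a b : nat)
    (f g : T -> 'M[R]_(a, b)) :
  (forall i j, continuous (fun x => f x i j)) ->
  (forall i j, continuous (fun x => g x i j)) ->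
  forall i j, continuous (fun x => (f x - g x) i j).
Proof.
move=> cf cg i j.
rewrite [X in continuous X](_ : _ = fun x => f x i j - g x i j).
  by move=> x; apply: cvgB; [exact: cf | exact: cg].
by apply/funext => x; rewrite !mxE.
Qed.

Lemma continuous_fnorm_sqr (R : realType) (T : topologicalType) (a b : nat)
    (f : T -> 'M[R]_(a, b)) :
  (forall i j, continuous (fun x => f x i j)) ->
  continuous (fun x => fnorm (f x) ^+ 2).
Proof.
move=> cf; under eq_fun do rewrite fnorm_sqr.
apply: continuous_sum => i; apply: continuous_sum => j x.
by rewrite /continuous_at; under eq_fun do rewrite expr2; apply: cvgM; exact: cf.
Qed.

Lemma closed_zero (R : realType) (T : topologicalType) (a b : nat)
    (f : T -> 'M[R]_(a, b)) :
  (forall i j, continuous (fun x => f x i j)) -> closed [set x | f x = 0].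
Proof.
move=> cf; rewrite [X in closed X](_ : _ =
    (fun x => fnorm (f x) ^+ 2) @^-1` [set x | x = 0]).
  apply: (proj1 (continuous_closedP _)); last exact: closed_eq.
  exact: continuous_fnorm_sqr.
apply/seteqP; split => x /=; first by move=> ->; apply/eqP; rewrite sqrf_eq0 fnorm_eq0.
by move/eqP; rewrite sqrf_eq0 fnorm_eq0 => /eqP.
Qed.

Lemma bounded_unit (R : realType) (n : nat) (K : set 'rV[R]_n) :
  (forall u, K u -> forall j, `|u 0 j| <= 1) -> bounded_set K.
Proof.
move=> K1; exists 1; split => // x x1 u Ku.
rewrite /= [leLHS]/Num.Def.normr /= mx_normrE; apply: bigmax_le.
  by apply: ltW; apply: lt_trans x1.
move=> [i j] _ /=; rewrite ord1; apply: le_trans (K1 u Ku j) _; exact: ltW.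
Qed.

Lemma proj_entry (R : realType) (m : nat) (P : 'M[R]_m) :
  is_proj P -> forall i j, `|P i j| <= 1.
Proof.
move=> [PP PT].
have E i : P i i = \sum_j P i j ^+ 2.
  rewrite -{1}PP mxE; apply: eq_bigr => j _.
  by rewrite -{2}PT mxE expr2.
have le i j : P i j ^+ 2 <= P i i.
  by rewrite E (bigD1 j)//= lerDl sumr_ge0// => k _; rewrite sqr_ge0.
have d1 i : P i i <= 1.
  have := le i i; case: (lerP (P i i) 1) => // Pi1.
  by rewrite leNgt expr2 ltr_pMr ?Pi1// (lt_trans ltr01).
move=> i j; rewrite -(@expr_le1 _ 2)// -normrX ger0_norm ?sqr_ge0//.
exact: le_trans (le i j) (d1 i).
Qed.

Lemma mu_attained (R : realType) (m n d : nat) (A : 'M[R]_(m, n))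
    (B : 'M[R]_(m, d)) :
  (exists k (Y : 'M[R]_(m, k)), mu A B = mu_obj A B Y) /\
  (forall k (Y : 'M[R]_(m, k)), mu A B <= mu_obj A B Y).
Proof.
pose g (P : 'M[R]_m) :=
  Num.sqrt (fnorm (P *m A) ^+ 2 + fnorm ((1%:M - P) *m B) ^+ 2).
pose K := [set u : 'rV[R]_(m * m) | is_proj (vec_mx u)].
have cv i j : continuous (fun u : 'rV[R]_(m * m) => (vec_mx u : 'M[R]_m) i j).
  by under eq_fun do rewrite mxE; exact: coord_continuous.
have cc (a b : nat) (M : 'M[R]_(a, b)) (i : 'I_a) (j : 'I_b) :
    continuous (fun u : 'rV[R]_(m * m) => M i j) by exact: cst_continuous.
have Kclosed : closed K.
  rewrite [K](_ : _ = [set u | vec_mx u *m vec_mx u - vec_mx u = 0 :> 'M[R]_m]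
                  `&` [set u | (vec_mx u)^T - vec_mx u = 0 :> 'M[R]_m]).
    apply: closedI; apply: closed_zero; apply: continuous_submx => //.
      exact: continuous_mulmx.
    by move=> i j; under eq_fun do rewrite mxE; exact: cv.
  apply/seteqP; split => u /=.
    by move=> [-> ->]; rewrite !subrr.
  by move=> [/eqP + /eqP]; rewrite !subr_eq0 => /eqP ? /eqP.
have Kcompact : compact K.
  apply: bounded_closed_compact => //; apply: bounded_unit => u Ku j.
  have := proj_entry Ku; rewrite -{2}(vec_mxK u).
  by case/mxvec_indexP: j => i j /(_ i j); rewrite mxvecE.
have K0 : K !=set0.
  by exists 0; rewrite /K /= /is_proj linear0 mul0mx trmx0.
have gc : {within K, continuous (fun u => g (vec_mx u))}.
  apply: continuous_subspaceT => u.
  apply: (@continuous_comp _ _ _ (fun u : 'rV[R]_(m * m) =>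
    fnorm (vec_mx u *m A) ^+ 2 + fnorm ((1%:M - vec_mx u) *m B) ^+ 2) Num.sqrt);
    last exact: sqrt_continuous.
  have c1 : continuous (fun u : 'rV[R]_(m * m) => fnorm (vec_mx u *m A) ^+ 2).
    by apply: continuous_fnorm_sqr; exact: continuous_mulmx.
  have c2 : continuous (fun u : 'rV[R]_(m * m) =>
      fnorm ((1%:M - vec_mx u) *m B) ^+ 2).
    apply: continuous_fnorm_sqr; apply: continuous_mulmx => //.
    exact: continuous_submx.
  exact: (cvgD (c1 u) (c2 u)).
have [u uK umin] := EVT_min_rV K0 Kcompact gc.
have lbY k (Y : 'M[R]_(m, k)) : g (vec_mx u) <= mu_obj A B Y.
  have := umin (mxvec (Y *m mpinv Y)); rewrite mxvecK; apply.
  by rewrite inE /K /= mxvecK; exact: mpinv_proj.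
have gu : g (vec_mx u) = mu_obj A B (vec_mx u).
  by rewrite /mu_obj proj_mpinv//; rewrite inE in uK.
suff -> : mu A B = g (vec_mx u).
  by split => //; exists m, (vec_mx u).
apply/eqP; rewrite eq_le; apply/andP; split.
  apply: ge_inf; last by exists m, (vec_mx u).
  by exists (g (vec_mx u)) => _ [k [Y ->]].
apply: lb_le_inf; first by exists (g (vec_mx u)), m, (vec_mx u).
by move=> _ [k [Y ->]].
Qed.

Lemma nu_attained (R : realType) (m n : nat) (A : 'M[R]_(m, n))
    (r : 'cV[R]_m) : (0 < n)%N -> r != 0 ->
  (exists2 p, fnorm p = 1 & nu A r = nu_obj A r p) /\
  (forall p, fnorm p = 1 -> nu_obj A r p <= nu A r).
Proof.
move=> n0 r0.
pose K := [set u : 'rV[R]_n | fnorm u^T = 1].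
have ct (i : 'I_n) j : continuous (fun u : 'rV[R]_n => u^T i j).
  by under eq_fun do rewrite mxE; exact: coord_continuous.
have cc (a b : nat) (M : 'M[R]_(a, b)) (i : 'I_a) (j : 'I_b) :
    continuous (fun u : 'rV[R]_n => M i j) by exact: cst_continuous.
have sq1 (x : 'cV[R]_n) : (fnorm x = 1) <-> (fnorm x ^+ 2 = 1).
  split => [->|]; first by rewrite expr1n.
  by move/eqP; rewrite sqrp_eq1 ?fnorm_ge0// => /eqP.
have Kclosed : closed K.
  rewrite [K](_ : _ = (fun u : 'rV[R]_n => fnorm u^T ^+ 2) @^-1` [set x | x = 1]).
    apply: (proj1 (continuous_closedP _)); last exact: closed_eq.
    exact: continuous_fnorm_sqr.
  by apply/seteqP; split => u /=; move/sq1.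
have Kcompact : compact K.
  apply: bounded_closed_compact => //; apply: bounded_unit => u Ku j.
  rewrite -(@expr_le1 _ 2)// -normrX ger0_norm ?sqr_ge0//.
  rewrite -(proj1 (sq1 _) Ku) fnorm_sqr (bigD1 j)//= big_ord1 mxE lerDl.
  by apply: sumr_ge0 => k _; rewrite big_ord1 sqr_ge0.
have K0 : K !=set0.
  exists (delta_mx 0 (Ordinal n0)); apply/sq1; rewrite fnorm_sqr.
  rewrite (bigD1 (Ordinal n0))//= big_ord1 !mxE !eqxx expr1n big1 ?addr0//.
  by move=> k kn0; rewrite big_ord1 !mxE eqxx (negPf kn0) expr0n.
have fc : {within K, continuous (fun u : 'rV[R]_n => nu_obj A r u^T)}.
  apply: continuous_subspaceT => u.
  have c1 : continuous (fun u : 'rV[R]_n => (u^T^T *m A^T *m r) 0 0).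
    apply: continuous_mulmx => //; apply: continuous_mulmx => // i j.
    by under eq_fun do rewrite trmxK; exact: coord_continuous.
  have c2 : continuous (fun u : 'rV[R]_n => fnorm (A *m u^T) ^+ 2).
    by apply: continuous_fnorm_sqr; exact: continuous_mulmx.
  have c3 : continuous (fun u : 'rV[R]_n =>
      Num.sqrt (fnorm (A *m u^T) ^+ 2 + fnorm r ^+ 2)).
    move=> v; apply: (@continuous_comp _ _ _ (fun u : 'rV[R]_n =>
      fnorm (A *m u^T) ^+ 2 + fnorm r ^+ 2) Num.sqrt); last exact: sqrt_continuous.
    exact: (cvgD (c2 v) (cvg_cst (fnorm r ^+ 2))).
  have c30 : Num.sqrt (fnorm (A *m u^T) ^+ 2 + fnorm r ^+ 2) != 0.
    by rewrite gt_eqF// sqrtr_gt0 ltr_wpDl ?sqr_ge0// exprn_gt0// lt0r fnorm_eq0 r0 fnorm_ge0.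
  exact: (cvgM (cvg_norm (c1 u)) (cvgV c30 (c3 u))).
have [u uK umax] := EVT_max_rV K0 Kcompact fc.
rewrite inE in uK.
have ub p : fnorm p = 1 -> nu_obj A r p <= nu_obj A r u^T.
  by move=> p1; have := umax p^T; rewrite trmxK; apply; rewrite inE /K /= trmxK.
suff -> : nu A r = nu_obj A r u^T by split => //; exists u^T.
apply/eqP; rewrite eq_le; apply/andP; split.
  apply: ge_sup; first by exists (nu_obj A r u^T), u^T.
  by move=> _ [p p1 <-]; exact: ub.
apply: ub_le_sup; last by exists u^T.
by exists (nu_obj A r u^T) => _ [p p1 <-]; exact: ub.
Qed.

(* Main.v *)
Require Import Defs.
From HB Require Import structures.
From mathcomp Require Import all_boot all_order all_algebra.
From mathcomp Require Import all_classical all_reals all_analysis.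
From mathcomp Require Import ring lra.

(** Write [rho] for the norm of [r], [b = A^T r], [M = A^T A + rho^2 I],
    [N = (SA)^T SA + rho^2 I], [w = M^-1 b] and [p = N^-1 b].

    The upper bound holds projector by projector: if [v] is a unit vector, then
    [|P A v| <= |P A|_F], so an optimal projector for [mu A r] gives at most the
    same value for the single column [A v].

    For the lower bound, split [a^T r = (P a)^T r + a^T (I - P) r] and apply
    Cauchy-Schwarz to each term and then to the pair of terms: for every
    orthogonal projector [P],
    [|a^T r| <= (|a|^2 + |r|^2)^(1/2) (|P a|^2 + |(I - P) r|^2)^(1/2)]
    ([mu_obj_inner_le]). For [a = A p / |p|] this says
    [p^T N p <= (p^T M p)^(1/2) mu (A p / |p|) r].

    On the other side, [nu A r] is the dual [M]-norm of [b], hence at most the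
    [M]-norm of [w] ([nu_sqr_le]). It remains to compare [p^T N p] with the
    product of the [M]-norms of [w] and [p], where [M w = N p]. The hypothesis
    on [S] gives [(1 - eta)^2 M <= N <= (1 + eta)^2 M] as soon as [eta <= 1],
    so [M^-1 N] is self-adjoint for [M] with spectrum between these two
    constants, and Kantorovich's inequality ([kantorovich]) bounds the cosine of
    the angle between [p] and [w = M^-1 N p] below by
    [2 (1 - eta^2) / ((1 - eta)^2 + (1 + eta)^2) = (1 - eta^2) / (1 + eta^2)].
    For [eta >= 1] the left-hand side of the theorem is not positive. *)

Set Implicit Arguments.
Unset Strict Implicit.
Unset Printing Implicit Defensive.

Import Order.TTheory GRing.Theory Num.Theory.

Local Open Scope ring_scope.

(** * Bilinear forms and the Frobenius norm *)

Definition bform (R : realType) (n : nat) (M : 'M[R]_n) (x y : 'cV[R]_n) : R :=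
  (x^T *m M *m y) 0 0.

Definition posdef (R : realType) (n : nat) (M : 'M[R]_n) : Prop :=
  M^T = M /\ forall x, x != 0 -> 0 < bform M x x.

Lemma bformDl (R : realType) (n : nat) (M : 'M[R]_n) (x y z : 'cV[R]_n) :
  bform M (x + y) z = bform M x z + bform M y z.
Proof. by rewrite /bform linearD/= !mulmxDl mxE. Qed.

Lemma bformDr (R : realType) (n : nat) (M : 'M[R]_n) (x y z : 'cV[R]_n) :
  bform M z (x + y) = bform M z x + bform M z y.
Proof. by rewrite /bform mulmxDr mxE. Qed.

Lemma bformZl (R : realType) (n : nat) (M : 'M[R]_n) a (x y : 'cV[R]_n) :
  bform M (a *: x) y = a * bform M x y.
Proof. by rewrite /bform linearZ/= -!scalemxAl mxE. Qed.

Lemma bformZr (R : realType) (n : nat) (M : 'M[R]_n) a (x y : 'cV[R]_n) :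
  bform M x (a *: y) = a * bform M x y.
Proof. by rewrite /bform -!scalemxAr mxE. Qed.

Definition bformE := (bformDl, bformDr, bformZl, bformZr).

Lemma bform_sym (R : realType) (n : nat) (M : 'M[R]_n) (x y : 'cV[R]_n) :
  M^T = M -> bform M x y = bform M y x.
Proof.
move=> MT; rewrite /bform -[RHS](mxE trmx_key (fun i j => (y^T *m M *m x) j i)).
by rewrite -[\matrix[_]_(_, _) _]/(trmx _) !trmx_mul trmxK MT mulmxA.
Qed.

Lemma bform_mx_sub (R : realType) (n : nat) (M N : 'M[R]_n) c (x y : 'cV[R]_n) :
  bform (N - c *: M) x y = bform N x y - c * bform M x y.
Proof.
by rewrite /bform mulmxDr mulmxDl mulmxN mulNmx -scalemxAr -scalemxAl !mxE.
Qed.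

Lemma eq_bform (R : realType) (n : nat) (M N : 'M[R]_n) (x y z : 'cV[R]_n) :
  M *m y = N *m z -> bform M x y = bform N x z.
Proof. by move=> e; rewrite /bform -!mulmxA e. Qed.

Lemma bform_ge0 (R : realType) (n : nat) (M : 'M[R]_n) (x : 'cV[R]_n) :
  posdef M -> 0 <= bform M x x.
Proof.
move=> [_ M0]; have [->|/M0/ltW//] := eqVneq x 0.
by rewrite /bform mulmx0 mxE.
Qed.

(** The discriminant argument: the form is nonnegative at
    [bform M y y *: x - bform M x y *: y]. *)
Lemma bform_CauchySchwarz (R : realType) (n : nat) (M : 'M[R]_n)
    (x y : 'cV[R]_n) :
  posdef M -> bform M x y ^+ 2 <= bform M x x * bform M y y.
Proof.
move=> Mpos; have [->|y0] := eqVneq y 0.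
  by rewrite /bform !mulmx0 !mxE expr0n mulr0.
have yy := Mpos.2 _ y0.
have := bform_ge0 (bform M y y *: x + (- bform M x y) *: y) Mpos.
rewrite !bformE (bform_sym y x Mpos.1).
set a := bform M x x; set b := bform M x y; set c := bform M y y => H.
rewrite -subr_ge0 -(pmulr_rge0 _ yy) -/c.
by apply: le_trans H _; rewrite le_eqVlt; apply/orP; left; apply/eqP; ring.
Qed.

Lemma fnorm_sqrE (R : realType) (n : nat) (x : 'cV[R]_n) :
  fnorm x ^+ 2 = (x^T *m x) 0 0.
Proof.
rewrite fnorm_sqr mxE; apply: eq_bigr => i _.
by rewrite big_ord1 mxE expr2.
Qed.

Lemma fnorm_gt0 (R : realType) (m n : nat) (A : 'M[R]_(m, n)) :
  (0 < fnorm A) = (A != 0).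
Proof. by rewrite lt0r fnorm_eq0 fnorm_ge0 andbT. Qed.

Lemma fnormZ (R : realType) (m n : nat) a (A : 'M[R]_(m, n)) :
  fnorm (a *: A) ^+ 2 = a ^+ 2 * fnorm A ^+ 2.
Proof.
rewrite !fnorm_sqr mulr_sumr; apply: eq_bigr => i _.
by rewrite mulr_sumr; apply: eq_bigr => j _; rewrite mxE exprMn.
Qed.

Lemma bform_gram (R : realType) (k n : nat) (C : 'M[R]_(k, n)) c
    (x : 'cV[R]_n) :
  bform (C^T *m C + c%:M) x x = fnorm (C *m x) ^+ 2 + c * fnorm x ^+ 2.
Proof.
rewrite /bform mulmxDr mulmxDl mul_mx_scalar -scalemxAl.
by rewrite mxE [X in _ + X]mxE !fnorm_sqrE trmx_mul !mulmxA.
Qed.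

(** The Tikhonov term makes the Gram matrix definite even when [C] has a
    kernel; for the theorem [c] is the squared norm of the residual [r]. *)
Lemma posdef_gram (R : realType) (k n : nat) (C : 'M[R]_(k, n)) c :
  0 < c -> posdef (C^T *m C + c%:M).
Proof.
move=> c0; split; first by rewrite linearD/= trmx_mul trmxK tr_scalar_mx.
move=> x x0; rewrite bform_gram ltr_wpDl ?sqr_ge0// mulr_gt0//.
by rewrite exprn_gt0// fnorm_gt0.
Qed.

Lemma posdef_unit (R : realType) (n : nat) (M : 'M[R]_n) :
  posdef M -> M \in unitmx.
Proof.
move=> [_ Mpos]; rewrite -row_free_unit; apply: inj_row_free => v vM.
apply/eqP/negPn/negP => v0.
have := Mpos v^T; rewrite /bform trmxK vM mul0mx mxE ltxx.
by rewrite -trmx0 (inj_eq trmx_inj) v0 => /(_ isT).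
Qed.

Lemma fnorm_CauchySchwarz (R : realType) (n : nat) (x y : 'cV[R]_n) :
  `|(x^T *m y) 0 0| <= fnorm x * fnorm y.
Proof.
have pos1 : posdef (1%:M : 'M[R]_n).
  split=> [|z z0]; first exact: tr_scalar_mx.
  by rewrite /bform mulmx1 -fnorm_sqrE exprn_gt0// fnorm_gt0.
have := bform_CauchySchwarz x y pos1.
rewrite /bform !mulmx1 -!fnorm_sqrE -exprMn -real_normK ?num_real//.
by rewrite ler_pXn2r// nnegrE mulr_ge0// fnorm_ge0.
Qed.

Lemma fnorm_mulmx_le (R : realType) (m n : nat) (Q : 'M[R]_(m, n))
    (v : 'cV[R]_n) : fnorm (Q *m v) <= fnorm Q * fnorm v.
Proof.
rewrite -(@ler_pXn2r _ 2)// ?nnegrE ?mulr_ge0 ?fnorm_ge0//.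
rewrite exprMn fnorm_sqr (fnorm_sqr Q) mulr_suml ler_sum// => i _.
rewrite big_ord1.
have -> : \sum_j Q i j ^+ 2 = fnorm (row i Q)^T ^+ 2.
  by rewrite fnorm_sqr; apply: eq_bigr => j _; rewrite big_ord1 !mxE.
rewrite -exprMn -real_normK ?num_real// ler_pXn2r// ?nnegrE ?mulr_ge0 ?fnorm_ge0//.
apply: le_trans (fnorm_CauchySchwarz _ _).
by rewrite trmxK -row_mul [row _ _ _ _]mxE.
Qed.

(** * Kantorovich's inequality *)

(** In the inner product of [M], the hypotheses on [D] say that the self-adjoint
    operator [M^-1 D] has norm at most [delta]; if [d = M^-1 D p] then
    [|d| <= delta |p|]. Stating this through forms avoids both the inverse and
    the square root of [M]. *)
Lemma bform_dominated (R : realType) (n : nat) (M D : 'M[R]_n) delta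
    (d p : 'cV[R]_n) :
    D^T = D -> 0 <= delta ->
    (forall x, `|bform D x x| <= delta * bform M x x) ->
    bform M d d = bform D d p ->
  bform M d d <= delta ^+ 2 * bform M p p.
Proof.
move=> DT delta0 Db dE.
(* Polarization: subtract the values of D at d + t p and d - t p, then use the
   parallelogram identity for M. *)
have H t : t * bform M d d *+ 2 <= delta * (bform M d d + t ^+ 2 * bform M p p).
  have := Db (d + t *: p); have := Db (d + (- t) *: p).
  rewrite !bformE (bform_sym p d DT) -dE !ler_norml => /andP[h1 _] /andP[_ h2].
  by rewrite mulr2n; move: h1 h2; rewrite expr2; lra.
(* The scale t = delta balances the two terms on the right; it is useless when
   delta = 0, where any positive scale already forces bform M d d <= 0. *)
have := delta0; rewrite le_eqVlt => /predU1P[d0|d0].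
  have := H 1; rewrite -d0 mul0r mul1r expr0n mul0r mulr2n; lra.
have := H delta; rewrite -mulrnAr ler_pM2l// mulr2n; lra.
Qed.

(** Kantorovich's inequality for the pencil [(M, N)], before the
    arithmetic-geometric mean step: with [H = M^-1 N] and [w = H p], it is
    [(H - alpha) (beta - H) >= 0] evaluated at [p] in the [M]-inner product.
    Centring [H] at [gamma], the midpoint of [alpha] and [beta], turns this into
    the norm bound [|(H - gamma) p| <= delta |p|], with [delta] the half-width. *)
Lemma kantorovich (R : realType) (n : nat) (M N : 'M[R]_n) alpha beta
    (w p : 'cV[R]_n) :
    M^T = M -> N^T = N -> alpha <= beta ->
    (forall x, alpha * bform M x x <= bform N x x <= beta * bform M x x) ->
    M *m w = N *m p ->
  bform M w w + alpha * beta * bform M p p <= (alpha + beta) * bform N p p.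
Proof.
move=> MT NT ab MN wp.
pose gamma := (alpha + beta) / 2; pose delta := (beta - alpha) / 2.
pose d := w - gamma *: p.
have : bform M d d <= delta ^+ 2 * bform M p p.
  apply: (@bform_dominated _ _ M (N - gamma *: M)).
  - by rewrite linearB linearZ/= MT NT.
  - by rewrite /delta; lra.
  - move=> x; rewrite bform_mx_sub ler_norml /gamma /delta.
    by have /andP[h1 h2] := MN x; apply/andP; split; lra.
  - apply: eq_bform.
    by rewrite /d mulmxBr mulmxBl wp -scalemxAr -scalemxAl.
rewrite /d -scaleNr !bformE (bform_sym w p MT) (eq_bform p wp) /gamma /delta.
by lra.
Qed.

(** * Bounds on the backward error and on the estimate *)

(** This links the backward error of a single column to the Karlson-Walden
    quotient: for [v = A q] with [q] a unit vector, dividing by the square root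
    gives [nu_obj A r q] as a lower bound of the objective over all projectors. *)
Lemma mu_obj_inner_le (R : realType) (m k : nat) (v r : 'cV[R]_m)
    (Y : 'M[R]_(m, k)) :
  `|(v^T *m r) 0 0| <= Num.sqrt (fnorm v ^+ 2 + fnorm r ^+ 2) * mu_obj v r Y.
Proof.
rewrite /mu_obj; have [] := mpinv_proj Y; move: (Y *m mpinv Y) => P PP PT.
have -> : v^T *m r = (P *m v)^T *m r + v^T *m ((1%:M - P) *m r).
  by rewrite trmx_mul PT -mulmxA -mulmxDr mulmxBl mul1mx addrC subrK.
rewrite mxE (le_trans (ler_normD _ _))//.
have h1 := fnorm_CauchySchwarz (P *m v) r.
have h2 := fnorm_CauchySchwarz v ((1%:M - P) *m r).
apply: le_trans (lerD h1 h2) _.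
set a := fnorm (P *m v); set b := fnorm r; set c := fnorm v; set d := fnorm _.
(* Cauchy-Schwarz in the plane, for a b + c d; the difference of the squares of
   the two sides is (a c - b d)^2. *)
rewrite -sqrtrM ?addr_ge0 ?sqr_ge0// -[leLHS]ger0_norm; last first.
  by rewrite addr_ge0// mulr_ge0// fnorm_ge0.
rewrite -sqrtr_sqr ler_wsqrtr// -subr_ge0.
apply: le_trans (sqr_ge0 (a * c - b * d)) _.
by rewrite le_eqVlt; apply/orP; left; apply/eqP; ring.
Qed.

(** Each projector for [A] is also a projector for [A *m v], and
    [|P A v| <= |P A|_F |v|]. *)
Lemma mu_mulmx_le (R : realType) (m n : nat) (A : 'M[R]_(m, n))
    (r : 'cV[R]_m) (v : 'cV[R]_n) :
  fnorm v <= 1 -> mu (A *m v) r <= mu A r.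
Proof.
move=> v1; have [[k [Y ->]] _] := mu_attained A r.
apply: le_trans ((mu_attained (A *m v) r).2 k Y) _.
rewrite /mu_obj ler_wsqrtr// lerD2r mulmxA ler_pXn2r ?nnegrE ?fnorm_ge0//.
by apply: le_trans (fnorm_mulmx_le _ _) _; rewrite ler_piMr ?fnorm_ge0.
Qed.

(** For a unit vector [q] the denominator of the quotient is the norm of [q] in
    the inner product of the regularized Gram matrix, and its numerator is the
    inner product of [q] and [w], so that Cauchy-Schwarz applies. *)
Lemma nu_sqr_le (R : realType) (m n : nat) (A : 'M[R]_(m, n))
    (r : 'cV[R]_m) (w : 'cV[R]_n) :
    (0 < n)%N -> r != 0 ->
    (A^T *m A + (fnorm r ^+ 2)%:M) *m w = A^T *m r ->
  nu A r ^+ 2 <= bform (A^T *m A + (fnorm r ^+ 2)%:M) w w.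
Proof.
move=> n0 r0; set M := _ + _ => Mw.
have rho0 : 0 < fnorm r ^+ 2 by rewrite exprn_gt0// fnorm_gt0.
have [[q q1 ->] _] := nu_attained A n0 r0.
have Mqq : fnorm (A *m q) ^+ 2 + fnorm r ^+ 2 = bform M q q.
  by rewrite /M bform_gram q1 expr1n mulr1.
have Mqq0 : 0 < bform M q q by rewrite -Mqq ltr_wpDl ?sqr_ge0.
rewrite /nu_obj Mqq -mulmxA -Mw mulmxA -/(bform M q w).
rewrite expr_div_n real_normK ?num_real// sqr_sqrtr ?(ltW Mqq0)// ler_pdivrMr//.
by rewrite mulrC bform_CauchySchwarz//; exact: posdef_gram.
Qed.

(** * The sketched estimate *)

Theorem theorem5 (R : realType) (m n s : nat)
    (hm : (0 < m)%N) (hn : (0 < n)%N) (hs : (0 < s)%N)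
    (A : 'M[R]_(m, n)) (r : 'cV[R]_m) (hAr : A^T *m r != 0)
    (S : 'M[R]_(s, m)) (eta : R) (heta : 0 <= eta)
    (hS : forall y : 'cV[R]_n,
        (1 - eta) * fnorm (A *m y) <= fnorm (S *m (A *m y))
          <= (1 + eta) * fnorm (A *m y)) :
  let p : 'cV[R]_n :=
    invmx ((S *m A)^T *m (S *m A) + (fnorm r ^+ 2)%:M) *m (A^T *m r) in
  (1 - eta ^+ 2) / (1 + eta ^+ 2) * nu A r
    <= mu ((fnorm p)^-1 *: (A *m p)) r <= mu A r.
Proof.
cbv zeta.
set N := _ + (fnorm r ^+ 2)%:M; set p := invmx N *m _.
have r0 : r != 0 by apply: contraNneq hAr => ->; rewrite mulmx0.
have rho0 : 0 < fnorm r ^+ 2 by rewrite exprn_gt0// fnorm_gt0.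
pose M : 'M[R]_n := A^T *m A + (fnorm r ^+ 2)%:M.
have Npos : posdef N by exact: posdef_gram.
have Mpos : posdef M by exact: posdef_gram.
have Np : N *m p = A^T *m r by rewrite mulKVmx// posdef_unit.
have p0 : p != 0 by apply: contraNneq hAr => p0; rewrite -Np p0 mulmx0.
have np0 : 0 < fnorm p by rewrite fnorm_gt0.
apply/andP; split; last first.
  rewrite scalemxAr; apply: mu_mulmx_le.
  rewrite -(@expr_le1 _ 2) ?fnorm_ge0// fnormZ exprVn mulVf//.
  by rewrite expf_neq0// gt_eqF.
have [[k [Y muE]] _] := mu_attained ((fnorm p)^-1 *: (A *m p)) r.
have mu0 : 0 <= mu ((fnorm p)^-1 *: (A *m p)) r by rewrite muE sqrtr_ge0.
(* The bound N >= (1 - eta)^2 M below needs eta <= 1 in the hypothesis on S,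
   where squaring preserves the order only if 1 - eta is nonnegative. *)
have [e1|e1] := leP 1 eta.
  have [[q q1 nuE] _] := nu_attained A hn r0.
  apply: le_trans mu0; rewrite nuE; apply: mulr_le0_ge0.
    rewrite pmulr_lle0 ?invr_gt0 ?ltr_wpDr ?sqr_ge0//.
    by rewrite subr_le0 -(expr1n _ 2) ler_pXn2r// nnegrE.
  by rewrite divr_ge0// sqrtr_ge0.
have Mp : 0 < bform M p p by exact: Mpos.2.
have mu_ge : bform N p p <= Num.sqrt (bform M p p) * mu ((fnorm p)^-1 *: (A *m p)) r.
  have := mu_obj_inner_le ((fnorm p)^-1 *: (A *m p)) r Y; rewrite -muE.
  move/(le_trans (ler_norm _)).
  rewrite linearZ/= -scalemxAl mxE trmx_mul -mulmxA -Np mulmxA -/(bform N p p).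
  rewrite ler_pdivrMl// mulrA -{1}(ger0_norm (ltW np0)) -sqrtr_sqr.
  rewrite -sqrtrM ?sqr_ge0// fnormZ mulrDr exprVn mulVKf; last first.
    by rewrite expf_neq0// gt_eqF.
  by rewrite (mulrC _ (fnorm r ^+ 2)) /M bform_gram.
pose w := invmx M *m (A^T *m r).
have Mw : M *m w = A^T *m r by rewrite mulKVmx// posdef_unit.
have nuw : nu A r ^+ 2 <= bform M w w by exact: nu_sqr_le.
have MN x : (1 - eta) ^+ 2 * bform M x x <= bform N x x
    <= (1 + eta) ^+ 2 * bform M x x.
  have /andP[l u] := hS x.
  rewrite /M /N !bform_gram -(mulmxA S) !mulrDr -!exprMn.
  apply/andP; split; apply: lerD.
  - by rewrite ler_pXn2r// ?nnegrE ?mulr_ge0 ?fnorm_ge0//; lra.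
  - rewrite ler_pXn2r// ?nnegrE ?mulr_ge0 ?fnorm_ge0//; last lra.
    by rewrite ler_piMl ?mulr_ge0 ?fnorm_ge0//; lra.
  - by rewrite ler_pXn2r// ?nnegrE ?mulr_ge0 ?fnorm_ge0//; lra.
  - rewrite ler_pXn2r// ?nnegrE ?mulr_ge0 ?fnorm_ge0//; last lra.
    by rewrite ler_peMl ?mulr_ge0 ?fnorm_ge0//; lra.
have := kantorovich Mpos.1 Npos.1 _ MN (etrans Mw (esym Np)).
have -> : (1 - eta) ^+ 2 <= (1 + eta) ^+ 2.
  by rewrite ler_pXn2r// ?nnegrE; lra.
move=> /(_ isT).
set P := Num.sqrt (bform M p p) in mu_ge.
have P0 : 0 < P by rewrite sqrtr_gt0.
have <- : P ^+ 2 = bform M p p by rewrite sqr_sqrtr// ltW.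
move=> kant.
have e2 : 0 < 1 + eta ^+ 2 by rewrite ltr_wpDr ?sqr_ge0.
rewrite mulrAC ler_pdivrMr// mulrC -(ler_pM2l P0).
move: mu_ge nuw kant; set V := nu A r; set U := mu _ _; set W := bform M w w.
set B := bform N p p => mu_ge nuw kant.
have h1 : V ^+ 2 + (1 - eta ^+ 2) ^+ 2 * P ^+ 2 <= 2 * ((1 + eta ^+ 2) * B).
  by lra.
have h2 : (1 + eta ^+ 2) * B <= (1 + eta ^+ 2) * (P * U) by rewrite ler_pM2l.
(* Arithmetic-geometric mean: the left-hand side of h1 is at least
   2 (1 - eta^2) V P. *)
have h3 := sqr_ge0 (V - (1 - eta ^+ 2) * P).
by lra.
Qed.
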